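(* Let $\pi$ be a regular multiforcing and $\xi\in|\pi|$. Then: (i) if $\mathrm{MT}(\pi)$ has the countable chain condition, $G\subseteq\mathrm{MT}(\pi)$ is generic over the ground universe $\mathbf V$, and $x\in\mathbf V[G]\cap2^\omega$, then $x\ne x_\xi[G]$ if and only if there is a small $\pi$-complete real name $c\subseteq\mathrm{MT}(\pi)\times(\omega\times2)$ (in $\mathbf V$), non-principal over $\pi$ at $\xi$, such that $x=c[G]$; (ii) if $c\subseteq\mathrm{MT}(\pi)\times(\omega\times2)$ is a $\pi$-complete real name, $\rho$ is a multiforcing such that $\rho$ avoids $c$ over $\pi$ at $\xi$, and $G\subseteq\mathrm{MT}(\pi\cup^{\mathrm{cw}}\rho)$ is generic over $\mathbf V$, then $c[G]\notin\bigcup_{Q\in\rho(\xi)}[Q]$.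
   Context: $\mathbf{PT}$: perfect trees $T\subseteq2^{<\omega}$; $[T]$ branches; $T|s=\{t\in T:s\subseteq t\lor t\subseteq s\}$; trees a.d. if their intersection is finite. Arboreal forcing: $\mathbb P\subseteq\mathbf{PT}$ with $T|u\in\mathbb P$ whenever $u\in T\in\mathbb P$; regular if for $S,T\in\mathbb P$, $[S]\cap[T]$ is clopen in $[S]$ or in $[T]$. $\mathbb P\sqsubset\mathbb Q$: every $T\in\mathbb P$ contains some $Q\in\mathbb Q$; every $Q\in\mathbb Q$ is covered by finitely many trees of $\mathbb P$; for $Q\in\mathbb Q,T\in\mathbb P$, $[Q]\cap[T]$ clopen in $[Q]$ and $T\not\subseteq Q$. Multiforcing: function $\pi$ with domain $|\pi|\subseteq\omega_1$ and arboreal forcings as values; regular if all values are regular; $\pi\sqsubset\rho$ iff $|\pi|\subseteq|\rho|$ and $\pi(\xi)\sqsubset\rho(\xi)$ for $\xi\in|\pi|$. Componentwise union $\pi\cup^{\mathrm{cw}}\rho$: domain $|\pi|\cup|\rho|$, value $\pi(\xi)$, $\rho(\xi)$, or $\pi(\xi)\cup\rho(\xi)$ according as $\xi$ is only in $|\pi|$, only in $|\rho|$, or in both. Multitree: function $p$ with finite domain $|p|\subseteq\omega_1$, values in $\mathbf{PT}$; $[p]=\{x\in(2^\omega)^{\omega_1}:\forall\xi\in|p|\,x(\xi)\in[p(\xi)]\}$; $\mathrm{MT}$ all multitrees; $\mathrm{MT}(\pi)=\{p:|p|\subseteq|\pi|,\ p(\xi)\in\pi(\xi)\}$ (the finite-support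 product), ordered by $q\le p$ iff $|p|\subseteq|q|$ and $q(\xi)\subseteq p(\xi)$ for $\xi\in|p|$. $p,q$ are sad if $p(\xi),q(\xi)$ are a.d. for some $\xi\in|p|\cap|q|$. For $G\subseteq\mathrm{MT}(\pi)$ generic, $x_\xi[G]$ is the unique real in $\bigcap\{[p(\xi)]:p\in G,\ \xi\in|p|\}$. Sealing: $u\sqsubseteq^{\mathrm{fin}}\bigvee Z$ means some finite $Z'\subseteq Z$ has $|v|=|u|$ for $v\in Z'$ and $[u]\subseteq\bigcup_{v\in Z'}[v]$. For $\Delta\subseteq\mathrm{MT}(\pi)$, $\pi\sqsubset_\Delta\rho$ means $\pi\sqsubset\rho$ and: whenever $p\in\mathrm{MT}(\pi)$, $u\in\mathrm{MT}(\rho)$, $|u|\subseteq|\pi|$, $|u|\cap|p|=\emptyset$, there is $q\in\mathrm{MT}(\pi)$, $q\le p$, $|q|\cap|u|=\emptyset$, with $u\sqsubseteq^{\mathrm{fin}}\bigvee\{u'\in\mathrm{MT}(\pi):|u'|=|u|,\ u'\cup q\in\Delta\}$. Real names: a real name is $c\subseteq\mathrm{MT}\times(\omega\times2)$ such that, with $K_{n,i}=\{p:\langle p,n,i\rangle\in c\}$, any $p\in K_{n,0},q\in K_{n,1}$ are sad; $K_n=K_{n,0}\cup K_{n,1}$; $c$ is small if every $K_n$ is countable; $c$ is $\pi$-complete if each $\{p\in\mathrm{MT}(\pi):\exists q\in K_n\,p\le q\}$ is pre-dense in $\mathrm{MT}(\pi)$. If $c\subseteq\mathrm{MT}(\pi)\times(\omega\times2)$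 and $G$ is a generic filter (on $\mathrm{MT}(\pi)$ or a larger set of multitrees containing it) then $c[G]\in2^\omega$ is defined by $c[G](n)=i$ iff $G\cap K_{n,i}\ne\emptyset$. $p$ directly forces $c(n)=i$ if $p\le q$ for some $q\in K_{n,i}$; directly forces $s\subset c$ if it directly forces $c(n)=s(n)$ for all $n<\mathrm{lh}(s)$; directly forces $c\notin[T]$ if it directly forces $s\subset c$ for some $s\in2^{<\omega}\setminus T$. $c$ is non-principal over $\pi$ at $\xi$ if $\{p\in\mathrm{MT}(\pi):\xi\in|p|,\ p\text{ directly forces }c\notin[p(\xi)]\}$ is open dense in $\mathrm{MT}(\pi)$. For $\pi\sqsubset\rho$, $\rho$ avoids $c$ over $\pi$ at $\xi$ if for each $Q\in\rho(\xi)$, $\pi\sqsubset_{\Delta_Q}\rho$ where $\Delta_Q=\{r\in\mathrm{MT}(\pi):\xi\in|r|,\ r\text{ directly forces }c\notin[Q]\}$. *)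

(* Defs.v *)
From HB Require Import structures.
From mathcomp Require Import all_boot.
From mathcomp Require Import boolp classical_sets functions cardinality wochoice.
From mathcomp Require Import topology cantor.

Set Implicit Arguments.
Unset Strict Implicit.
Unset Printing Implicit Defensive.

Local Open Scope classical_set_scope.

(* The Rocq universe plays the role of the ground universe V.  V-generic
   filters do not exist in V, so a statement about all G generic over V and all
   x in V[G] is interpreted through the forcing relation: it is forced by every
   condition, for every name of x.  The forcing relation is the usual (weak)
   one, given by recursion on P-names for the atomic formulas and by
   combinators for the connectives and quantifiers. *)

Record forcing_notion := ForcingNotion {
  cond :> Type;
  fle : cond -> cond -> Prop;
  fle_refl : forall p, fle p p;
  fle_trans : forall q p r, fle p q -> fle q r -> fle p r }.

Section Forcing.
Variable P : forcing_notion.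
Implicit Types p q r : P.

Inductive name : Type :=
  Name (I : Type) (elt : I -> name) (weight : I -> P).

(* A formula of the forcing language is the set of conditions forcing it. *)
Definition formula := P -> Prop.
Implicit Types A B : formula.

Definition dense_below A : formula :=
  fun p => forall q, fle q p -> exists2 r, fle r q & A r.

Definition fand A B : formula := fun p => A p /\ B p.
Definition fimp A B : formula := fun p => forall q, fle q p -> A q -> B q.
Definition fiff A B : formula := fand (fimp A B) (fimp B A).
Definition fnot A : formula := fun p => forall q, fle q p -> ~ A q.
Definition fall (X : Type) (A : X -> formula) : formula :=
  fun p => forall x, A x p.
Definition fex (X : Type) (A : X -> formula) : formula :=
  dense_below (fun p => exists x, A x p).

(* A statement about ground model objects only, read in V. *)
Definition fground (S : Prop) : formula := fun _ => S.

(* q belongs to G *)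
Definition fgen q : formula := dense_below (fun p => fle p q).

Fixpoint feq (s t : name) {struct s} : formula :=
  let: Name D x a := s in
  let: Name E y b := t in
  fun p =>
    (forall i q, fle q p -> fle q (a i) ->
      dense_below (fun r => exists2 j, fle r (b j) & feq (x i) (y j) r) q) /\
    (forall j q, fle q p -> fle q (b j) ->
      dense_below (fun r => exists2 i, fle r (a i) & feq (x i) (y j) r) q).

Definition fmem (s t : name) : formula :=
  let: Name E y b := t in
  dense_below (fun r => exists2 j, fle r (b j) & feq s (y j) r).

(* The formula is true in V[G] for every G generic over V. *)
Definition holds A := forall p, A p.

Definition nempty : name :=
  Name (fun v : void => match v with end) (fun v : void => match v with end).

(* s U {t}; giving t every condition as weight dispenses with a top element. *)
Definition nadjoin (s t : name) : name :=
  let: Name D x a := s in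
  Name (fun z : D + P => match z with inl i => x i | inr _ => t end)
       (fun z : D + P => match z with inl i => a i | inr p => p end).

Definition npair (s t : name) : name := nadjoin (nadjoin nempty s) t.
Definition nopair (s t : name) : name := npair (npair s s) (npair s t).

(* canonical name of the von Neumann numeral n *)
Fixpoint nnat (n : nat) : name :=
  if n is m.+1 then nadjoin (nnat m) (nnat m) else nempty.

(* canonical name of the ordered pair <n, i>, with 2 = {0, 1} *)
Definition npoint (n : nat) (i : bool) : name :=
  nopair (nnat n) (nnat (nat_of_bool i)).

(* x belongs to 2^omega, that is, x is a function from omega to 2 *)
Definition freal (x : name) : formula :=
  fand (fall (fun z : name => fimp (fmem z x)
         (fex (fun n : nat => fex (fun i : bool => feq z (npoint n i))))))
  (fand (fall (fun n : nat => fex (fun i : bool => fmem (npoint n i) x)))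
        (fall (fun n : nat => fall (fun i : bool => fall (fun j : bool =>
          fimp (fand (fmem (npoint n i) x) (fmem (npoint n j) x))
               (fground (i = j))))))).

(* s is an initial segment of x *)
Definition finit (s : seq bool) (x : name) : formula :=
  fall (fun n : nat => fimp (fground (n < size s))
                            (fmem (npoint n (nth false s n)) x)).

(* x belongs to [T], for x in 2^omega and T a tree of V; [T] is computed in
   V[G].  If x is only a partial function, then the negation still says that
   some s outside T is an initial segment of x. *)
Definition fbranch (T : set (seq bool)) (x : name) : formula :=
  fall (fun s : seq bool => fimp (finit s x) (fground (T s))).

End Forcing.

Arguments nnat {P} n.
Arguments npoint {P} n i.

Definition tree := set (seq bool).

Definition perfect_tree (T : tree) : Prop :=
  [/\ T !=set0,
      forall s t, prefix s t -> T t -> T s &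
      forall s, T s -> exists t, [/\ prefix s t, T t,
        T (rcons t false) & T (rcons t true)]].

Definition branches (T : tree) : set cantor_space :=
  [set x : cantor_space | forall n, T (mkseq x n)].

Definition tree_restrict (T : tree) (s : seq bool) : tree :=
  [set t | T t /\ (prefix s t || prefix t s)].

Definition almost_disjoint (S T : tree) : Prop := finite_set (S `&` T).

Definition clopen_in (A B : set cantor_space) : Prop :=
  clopen (A : set (subspace B)).

Definition arboreal (P : set tree) : Prop :=
  P `<=` perfect_tree /\ forall T u, P T -> T u -> P (tree_restrict T u).

Definition regular_forcing (P : set tree) : Prop :=
  forall S T, P S -> P T ->
    clopen_in (branches S `&` branches T) (branches S) \/
    clopen_in (branches S `&` branches T) (branches T).

Definition refines (P Q : set tree) : Prop :=
  [/\ forall T, P T -> exists2 S, Q S & S `<=` T,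
      forall S, Q S -> exists D : set tree,
        [/\ finite_set D, D `<=` P & S `<=` \bigcup_(T in D) T] &
      forall S T, Q S -> P T ->
        clopen_in (branches S `&` branches T) (branches S) /\ ~ (T `<=` S)].

(* The order type of R is omega_1.  Any two
   such well-orders are isomorphic. *)
Definition is_omega1 (W : Type) (R : rel W) : Prop :=
  [/\ well_order R, ~ countable [set: W] &
      forall a, countable [set b | R b a]].

(* Functions with domain included in W. *)
Definition pfun (W A : Type) := W -> option A.

Section Multi.
Variable W : Type.

Definition dom (A : Type) (f : pfun W A) : set W := [set a | isSome (f a)].

Definition mforcing := pfun W (set tree).
Definition ptrees := pfun W tree.
Implicit Types (pi rho : mforcing) (p q r u v : ptrees).

Definition multiforcing pi : Prop := forall a P, pi a = Some P -> arboreal P.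

Definition regular pi : Prop := forall a P, pi a = Some P -> regular_forcing P.

Definition mrefines pi rho : Prop :=
  dom pi `<=` dom rho /\
  forall a P Q, pi a = Some P -> rho a = Some Q -> refines P Q.

Definition cwunion pi rho : mforcing := fun a =>
  match pi a, rho a with
  | Some P, Some Q => Some (P `|` Q)
  | Some P, None => Some P
  | None, o => o
  end.

Definition multitree : set ptrees :=
  [set p | finite_set (dom p) /\ forall a T, p a = Some T -> perfect_tree T].

Definition MT pi : set ptrees :=
  [set p | multitree p /\
     forall a T, p a = Some T -> exists2 P, pi a = Some P & P T].

(* [p] *)
Definition mbody p : set (W -> cantor_space) :=
  [set x | forall a T, p a = Some T -> branches T (x a)].

(* q <= p *)
Definition mle q p : Prop :=
  forall a T, p a = Some T -> exists2 S, q a = Some S & S `<=` T.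

Lemma mle_refl p : mle p p.
Proof. by move=> a T paT; exists T. Qed.

Lemma mle_trans q p r : mle p q -> mle q r -> mle p r.
Proof.
move=> pq qr a T /qr[S /pq[U pU US] ST].
by exists U => //; exact: subset_trans ST.
Qed.

Definition MT_forcing pi : forcing_notion :=
  @ForcingNotion {p : ptrees | MT pi p} (fun x y => mle (sval x) (sval y))
    (fun x => @mle_refl (sval x))
    (fun y x z => @mle_trans (sval y) (sval x) (sval z)).

Definition sad p q : Prop :=
  exists a S T, [/\ p a = Some S, q a = Some T & almost_disjoint S T].

Definition compatible (M : set ptrees) p q : Prop :=
  exists r, [/\ M r, mle r p & mle r q].

Definition predense (D M : set ptrees) : Prop :=
  forall p, M p -> exists2 q, D q & compatible M p q.

Definition open_dense (D M : set ptrees) : Prop :=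
  [/\ D `<=` M,
      forall p q, D p -> M q -> mle q p -> D q &
      forall p, M p -> exists2 q, D q & mle q p].

Definition ccc (M : set ptrees) : Prop :=
  forall A : set ptrees, A `<=` M ->
    (forall p q, A p -> A q -> p <> q -> ~ compatible M p q) ->
    countable A.

(* union of two functions with disjoint domains *)
Definition punion p q : ptrees := fun a => if p a is Some T then Some T else q a.

(* u is finitely covered by Z *)
Definition fin_covered u (Z : set ptrees) : Prop :=
  exists Z' : set ptrees,
    [/\ Z' `<=` Z, finite_set Z', forall v, Z' v -> dom v = dom u &
        mbody u `<=` \bigcup_(v in Z') mbody v].

Definition sealed_refines (Delta : set ptrees) pi rho : Prop :=
  mrefines pi rho /\
  forall p u, MT pi p -> MT rho u -> dom u `<=` dom pi ->
    dom u `&` dom p = set0 ->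
    exists q, [/\ MT pi q, mle q p, dom q `&` dom u = set0 &
      fin_covered u [set u' | [/\ MT pi u', dom u' = dom u &
                                  Delta (punion u' q)]]].

(* subsets of MT x (omega x 2), with 2 = {false, true} *)
Definition names := set (ptrees * (nat * bool)).
Implicit Types c : names.

(* K_{n,i} and K_n *)
Definition Kni c n i : set ptrees := [set p | c (p, (n, i))].
Definition Kn c n : set ptrees := Kni c n false `|` Kni c n true.

Definition real_name c : Prop :=
  (forall p n i, c (p, (n, i)) -> multitree p) /\
  (forall n p q, Kni c n false p -> Kni c n true q -> sad p q).

(* c is a subset of M x (omega x 2) *)
Definition name_over (M : set ptrees) c : Prop :=
  forall p n i, c (p, (n, i)) -> M p.

Definition small c : Prop := forall n, countable (Kn c n).

Definition complete pi c : Prop :=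
  forall n, predense [set p | MT pi p /\ exists2 q, Kn c n q & mle p q] (MT pi).

Definition dforces_value c p n i : Prop := exists2 q, Kni c n i q & mle p q.

Definition dforces_init c p (s : seq bool) : Prop :=
  forall n, n < size s -> dforces_value c p n (nth false s n).

Definition dforces_notin c p (T : tree) : Prop :=
  exists2 s, ~ T s & dforces_init c p s.

Definition non_principal pi a c : Prop :=
  open_dense [set p | MT pi p /\ exists2 T, p a = Some T & dforces_notin c p T]
             (MT pi).

Definition avoids rho c pi a : Prop :=
  mrefines pi rho /\
  forall R Q, rho a = Some R -> R Q ->
    sealed_refines [set r | [/\ MT pi r, dom r a & dforces_notin c r Q]] pi rho.

(* c[G] for G generic on MT pi: the set of the <n, i> such that G meets
   K_{n,i}, as the name {(<n, i>, p) : (p, n, i) in c}.  Elements of c whose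
   condition is outside MT pi are dropped, as they cannot belong to G. *)
Definition cname pi c : name (MT_forcing pi) :=
  Name (fun z : {y : MT_forcing pi * (nat * bool) | c (sval y.1, y.2)} =>
          npoint (sval z).2.1 (sval z).2.2)
       (fun z => (sval z).1).

(* The real x is x_a[G], the point of the intersection of the [p(a)] over the
   p in G with a in the domain of p (a single point if pi(a) is nonempty). *)
Definition fgeneric_real pi a (x : name (MT_forcing pi)) :
    formula (MT_forcing pi) :=
  fall (fun p : MT_forcing pi => fall (fun T : tree =>
    fimp (fground (sval p a = Some T)) (fimp (fgen p) (fbranch T x)))).

End Multi.

(* Main.v *)
(* (i) If q0 forces x to be a real other than the generic one, a maximal
   antichain of conditions deciding the n-th digit of x, for each n, gives the
   name c: it is small by the ccc, and regularity turns incompatibility into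
   sadness.  As c must be non-principal everywhere, x is replaced by a ground
   model real outside of q0.
   (ii) A condition of the union splits into a part in MT(pi) and a part in
   MT(rho).  By sealing, the first can be extended to some q such that the second
   is covered by multitrees which together with q directly force c out of [Q];
   since [Q'] meets [T] in a clopen subset of [Q'], the second part can be
   shrunk into one of these multitrees. *)
Require Import Defs.
From mathcomp Require Import all_boot.
From mathcomp Require Import boolp classical_sets functions cardinality wochoice.
From mathcomp Require Import topology cantor.

Set Implicit Arguments.
Unset Strict Implicit.
Unset Printing Implicit Defensive.

Local Open Scope classical_set_scope.

Lemma extend_to_branch (A : tree) (s : seq bool) :
  A s -> (forall t, A t -> exists b, A (rcons t b)) ->
  exists x : cantor_space, mkseq x (size s) = s /\
    forall n, size s <= n -> A (mkseq x n).
Proof.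
move=> As stepA.
pose f t := rcons t `[< A (rcons t true) >].
pose g n := iter n f s.
have fA t : A t -> A (f t).
  move=> /stepA[b Ab]; rewrite /f; case: asboolP => // nA.
  by case: b Ab.
have gA n : A (g n) by elim: n => //= n; exact: fA.
have size_g n : size (g n) = size s + n.
  by elim: n => [|n IH]; rewrite ?addn0//= size_rcons -/(g n) IH addnS.
have nth_g n m k : k < size s + n -> nth false (g (n + m)) k = nth false (g n) k.
  move=> kn; elim: m => [|m IH]; first by rewrite addn0.
  rewrite addnS /= -/(g (n + m)) nth_rcons size_g ifT ?IH//.
  by rewrite (leq_trans kn)// leq_add2l leq_addr.
pose x : cantor_space := fun k => nth false (g k.+1) k.
have gE n : mkseq x (size s + n) = g n.
  apply: (@eq_from_nth _ false); first by rewrite size_mkseq size_g.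
  move=> k; rewrite size_mkseq => kn; rewrite nth_mkseq// /x.
  have kk : k < size s + k.+1 by rewrite addnS ltnS leq_addl.
  by rewrite -(nth_g _ k.+1 _ kn) addnC nth_g.
exists x; split; first by have := gE 0; rewrite addn0.
by move=> n /subnKC <-; rewrite gE.
Qed.

Lemma take_mkseq (x : nat -> bool) m n : m <= n ->
  take m (mkseq x n) = mkseq x m.
Proof. by move=> mn; rewrite /mkseq -map_take take_iota (minn_idPl mn). Qed.

Lemma mkseq_prefix (x : nat -> bool) n t : prefix t (mkseq x n) ->
  t = mkseq x (size t).
Proof.
move=> tx; have := size_prefix tx; rewrite size_mkseq => tn.
rewrite -[LHS](eqP (_ : take (size t) (mkseq x n) == t)).
  by rewrite take_mkseq.
by rewrite -prefixE.
Qed.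

Lemma prefix_mkseq (x : nat -> bool) m n : m <= n ->
  prefix (mkseq x m) (mkseq x n).
Proof. by move=> mn; rewrite prefixE size_mkseq take_mkseq. Qed.

Lemma perfect_child (T : tree) s : perfect_tree T -> T s ->
  exists b, T (rcons s b).
Proof.
move=> [_ dT splitT] /splitT[t [st _ t0 _]].
exists (nth false (rcons t false) (size s)); apply: dT t0.
move: st => /prefixP[v ->].
rewrite -cats1 -cats1 -catA nth_cat ltnn subnn prefix_catr// eqxx /=.
by case: v => [|b v] //=; rewrite eqxx prefix0s.
Qed.

Lemma perfect_branch (T : tree) s : perfect_tree T -> T s ->
  exists2 x, branches T x & mkseq x (size s) = s.
Proof.
move=> pT Ts; have [_ dT _] := pT.
have [x [xs xT]] := extend_to_branch Ts (fun t => @perfect_child T t pT).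
exists x => // n; case: (leqP (size s) n) => [/xT//|ns].
by apply: dT Ts; rewrite -xs prefix_mkseq// ltnW.
Qed.

Lemma infinite_tree_branch (A : tree) :
  (forall s t, prefix s t -> A t -> A s) -> infinite_set A ->
  exists x, branches A x.
Proof.
move=> dA infA.
pose above s := A `&` [set t | prefix s t].
have [||x [_ xB]] := @extend_to_branch (fun s => infinite_set (above s)) [::].
- by apply: contra_not infA; apply: sub_finite_set => t At; split=> //=;
    rewrite prefix0s.
- move=> s infs; apply: contrapT => nb; apply: infs.
  have fb b : finite_set (above (rcons s b)).
    by apply: contrapT => nf; apply: nb; exists b.
  apply: (@sub_finite_set _ _
    ([set s] `|` (above (rcons s false) `|` above (rcons s true)))).
    move=> t [At /= /prefixP[[|b v] tE]].
      by left; rewrite /= tE cats0.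
    by right; case: b tE => tE; [right|left]; split=> //=;
      rewrite tE -cat_rcons prefix_prefix.
  by rewrite !finite_setU; split; [exact: finite_set1|split; exact: fb].
exists x => n; have /infinite_setN0[t [At /= xt]] := xB n (leq0n n).
exact: dA At.
Qed.

Lemma cantor_nbhs (x : cantor_space) (U : set cantor_space) : nbhs x U ->
  exists n, forall y : cantor_space, mkseq y n = mkseq x n :> seq bool -> U y.
Proof.
pose cyl n := [set y : cantor_space | mkseq y n = mkseq x n :> seq bool].
pose F : set_system cantor_space := filter_from setT cyl.
have FF : Filter F.
  apply: filter_from_filter; first by exists 0.
  move=> m n _ _; exists (maxn m n) => // y; rewrite /cyl /= => yx; split.
      by rewrite -!(take_mkseq _ (leq_maxl m n)) yx.
  by rewrite -!(take_mkseq _ (leq_maxr m n)) yx.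
suff Fx : F --> x by move=> /Fx[n _ cylU]; exists n.
apply/cvg_sup => k A /= [_ [[B _ <-] Bxk] BA].
exists k.+1 => // y /= yx; apply: BA => /=.
have := congr1 (nth false ^~ k) yx.
by rewrite !nth_mkseq// => ->.
Qed.

Lemma clopen_in_shrink (S T : tree) : perfect_tree S ->
  clopen_in (branches S `&` branches T) (branches S) ->
  forall x, branches S x -> branches T x ->
  exists2 u, S u & tree_restrict S u `<=` T.
Proof.
move=> pS [opST _] x Sx Tx.
have /(nbhs_subspace_ex _ Sx)[V /cantor_nbhs[n nV] STV] :
    nbhs (x : subspace (branches S)) (branches S `&` branches T).
  by apply: open_nbhs_nbhs; split.
exists (mkseq x n) => // t [St] /orP[xt|/mkseq_prefix -> //].
have [y Sy yt] := perfect_branch pS St.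
have yx : mkseq y n = mkseq x n :> seq bool.
  by move: xt; rewrite -yt => /mkseq_prefix; rewrite size_mkseq => ->.
have [[_ Ty] _] : ((branches S `&` branches T) `&` branches S) y.
  by rewrite STV; split => //; exact: nV.
by rewrite -yt.
Qed.

Lemma perfect_not_ad_branch (S T : tree) : perfect_tree S -> perfect_tree T ->
  ~ almost_disjoint S T -> exists x, branches S x /\ branches T x.
Proof.
move=> [_ dS _] [_ dT _] /infinite_tree_branch[|x xST].
  by move=> s t st [St Tt]; split; [exact: dS St|exact: dT Tt].
by exists x; split=> n; case: (xST n).
Qed.

Section Multitrees.
Variable W : Type.
Implicit Types (pi rho : mforcing W) (p q r u v : ptrees W).

Lemma sub_finite_dom p q r : finite_set (dom p) -> finite_set (dom q) ->
  (forall a, r a -> p a \/ q a) -> finite_set (dom r).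
Proof.
move=> fp fq rpq; apply: (@sub_finite_set _ _ (dom p `|` dom q)).
  by move=> a /rpq.
by rewrite finite_setU.
Qed.

Lemma MTI pi p : multiforcing pi -> finite_set (dom p) ->
  (forall a T, p a = Some T -> exists2 P, pi a = Some P & P T) -> MT pi p.
Proof.
move=> mpi fp ppi; split=> //; split=> // a T /ppi[P /mpi[sP _]]; exact: sP.
Qed.

Lemma regular_compatible pi p q : multiforcing pi -> regular pi ->
  MT pi p -> MT pi q -> ~ sad p q -> compatible (MT pi) p q.
Proof.
move=> mpi rpi [[fp perp] ppi] [[fq perq] qpi] nsad.
have /choice[r rP] : forall a, exists o : option tree,
    [/\ o -> p a \/ q a,
        forall V, o = Some V -> exists2 P, pi a = Some P & P V,
        forall T, p a = Some T -> exists2 V, o = Some V & V `<=` T &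
        forall T, q a = Some T -> exists2 V, o = Some V & V `<=` T].
  move=> a; case pa: (p a) => [S|]; case qa: (q a) => [T|]; last 1 first.
  - by exists None; split.
  - have nad : ~ almost_disjoint S T.
      by move=> ST; apply: nsad; exists a, S, T.
    have [P piP PS] := ppi _ _ pa; have [P' + PT] := qpi _ _ qa.
    rewrite piP => -[PP']; rewrite -PP' in PT.
    have [perS perT] := (perp _ _ pa, perq _ _ qa).
    have [_ restrP] := mpi _ _ piP.
    have [x [Sx Tx]] := perfect_not_ad_branch perS perT nad.
    have [cl|cl] := rpi _ _ piP _ _ PS PT.
      have [u Su SuT] := clopen_in_shrink perS cl Sx Tx.
      exists (Some (tree_restrict S u)); split=> [|V [<-]|_ [<-]|_ [<-]].
      + by left.
      + by exists P => //; exact: restrP.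
      + by exists (tree_restrict S u) => // t [].
      + by exists (tree_restrict S u).
    rewrite setIC in cl; have [u Tu TuS] := clopen_in_shrink perT cl Tx Sx.
    exists (Some (tree_restrict T u)); split=> [|V [<-]|_ [<-]|_ [<-]].
    + by left.
    + by exists P => //; exact: restrP.
    + by exists (tree_restrict T u).
    + by exists (tree_restrict T u) => // t [].
  - exists (Some S); split=> [|_ [<-]|_ [<-]|] //; first by left.
      exact: ppi.
    by exists S.
  - exists (Some T); split=> [|_ [<-]| |_ [<-]] //; first by right.
      exact: qpi.
    by exists T.
exists r; split; last 2 first.
- by move=> a T; case: (rP a) => _ _ + _; apply.
- by move=> a T; case: (rP a) => _ _ _; apply.
apply: MTI => //; last by move=> a T; case: (rP a) => _ + _ _; apply.
by apply: (sub_finite_dom fp fq) => a; case: (rP a).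
Qed.

Lemma MT_extend pi p a T : multiforcing pi -> MT pi p ->
  (exists2 P, pi a = Some P & P T) ->
  (forall S, p a = Some S -> T `<=` S) ->
  exists r, [/\ MT pi r, mle r p & r a = Some T].
Proof.
move=> mpi [[fp _] ppi] piT TS.
pose r : ptrees W := fun b => if `[< b = a >] then Some T else p b.
have ra : r a = Some T by rewrite /r; case: asboolP.
exists r; split=> //; last first.
  move=> b S pb; case: (pselect (b = a)) => [ba|ba].
    by rewrite ba in pb *; exists T => //; exact: TS.
  by exists S => //; rewrite /r; case: asboolP.
apply: MTI => //; last first.
  by move=> b S; rewrite /r; case: asboolP => [-> [<-]|_ /ppi].
apply: (@sub_finite_set _ _ ([set a] `|` dom p)).
  by move=> b; rewrite /dom /= /r; case: asboolP => [->|]; [left|right].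
by rewrite finite_setU; split=> //; exact: finite_set1.
Qed.

Lemma mbody_nonempty p : (forall a T, p a = Some T -> perfect_tree T) ->
  exists x, mbody p x.
Proof.
move=> perp.
have /choice[x xP] : forall a, exists y : cantor_space,
    forall T, p a = Some T -> branches T y.
  move=> a; case pa: (p a) => [T|]; last by exists (fun=> false).
  have pT := perp _ _ pa; have [[s Ts] _ _] := pT.
  by have [y Ty _] := perfect_branch pT Ts; exists y => _ [<-].
by exists x => a T /xP.
Qed.

Lemma fin_covered_meet pi rho u Z : multiforcing rho -> mrefines pi rho ->
  MT rho u -> (forall v, Z v -> MT pi v) -> fin_covered u Z ->
  exists v w, [/\ Z v, dom w = dom u, MT rho w, mle w u & mle w v].
Proof.
move=> mrho [_ ref] [[fu peru] urho] ZMT [Z' [Z'Z _ domZ' uZ']].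
have [x ux] := mbody_nonempty peru; have [v Z'v vx] := uZ' _ ux.
have [[_ perv] vpi] := ZMT _ (Z'Z _ Z'v).
have /choice[w wP] : forall a, exists o : option tree,
    [/\ isSome o = isSome (u a),
        forall S, o = Some S -> exists2 Q, rho a = Some Q & Q S,
        forall T, u a = Some T -> exists2 S, o = Some S & S `<=` T &
        forall T, v a = Some T -> exists2 S, o = Some S & S `<=` T].
  move=> a; case ua: (u a) => [S|]; case va: (v a) => [T|].
  - have [[Q rhoQ QS] [P piP PT]] := (urho _ _ ua, vpi _ _ va).
    have [_ restrQ] := mrho _ _ rhoQ.
    have [_ _ /(_ _ _ QS PT)[cl _]] := ref _ _ _ piP rhoQ.
    have [t St StT] := clopen_in_shrink (peru _ _ ua) cl (ux _ _ ua) (vx _ _ va).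
    exists (Some (tree_restrict S t)); split=> // [_ [<-]|_ [<-]|_ [<-]].
    + by exists Q => //; exact: restrQ.
    + by exists (tree_restrict S t) => // r [].
    + by exists (tree_restrict S t).
  - have : dom u a by rewrite /dom /= ua.
    by rewrite -(domZ' _ Z'v) /dom /= va.
  - have : dom v a by rewrite /dom /= va.
    by rewrite (domZ' _ Z'v) /dom /= ua.
  - by exists None.
exists v, w; have domw : dom w = dom u.
  by apply/seteqP; split=> a; rewrite /dom /=; case: (wP a) => ->.
split=> //; first exact: Z'Z.
- by apply: MTI; rewrite ?domw// => a T; case: (wP a) => _ + _ _; apply.
- by move=> a T; case: (wP a) => _ _ + _; apply.
- by move=> a T; case: (wP a) => _ _ _; apply.
Qed.

Lemma cwunionl pi rho a P T : pi a = Some P -> P T ->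
  exists2 Q, cwunion pi rho a = Some Q & Q T.
Proof.
move=> piP PT; rewrite /cwunion piP; case: (rho a) => [R|]; last by exists P.
by exists (P `|` R) => //; left.
Qed.

Lemma cwunionr pi rho a R T : rho a = Some R -> R T ->
  exists2 Q, cwunion pi rho a = Some Q & Q T.
Proof.
move=> rhoR RT; rewrite /cwunion rhoR; case: (pi a) => [P|]; last by exists R.
by exists (P `|` R) => //; right.
Qed.

Lemma cwunion_multiforcing pi rho : multiforcing pi -> multiforcing rho ->
  multiforcing (cwunion pi rho).
Proof.
move=> mpi mrho a P; rewrite /cwunion.
case piP: (pi a) => [Q|]; case rhoP: (rho a) => [R|] //.
- have [[Qper Qres] [Rper Rres]] := (mpi _ _ piP, mrho _ _ rhoP).
  move=> [<-]; split=> [T [/Qper|/Rper]//|T u [QT|RT] Tu].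
    by left; exact: Qres.
  by right; exact: Rres.
- by move=> [<-]; exact: mpi piP.
- by move=> [<-]; exact: mrho rhoP.
Qed.

Lemma MT_cwunionl pi rho p : MT pi p -> MT (cwunion pi rho) p.
Proof.
by move=> [mp ppi]; split=> // a T /ppi[P piP PT]; exact: cwunionl PT.
Qed.

(* Split q into its part p in MT(pi), its part u in MT(rho) over |pi|, and its
   part outside |pi|, which sealing does not touch. *)
Lemma sealed_predense Delta pi rho q : multiforcing pi -> multiforcing rho ->
  sealed_refines Delta pi rho -> MT (cwunion pi rho) q ->
  exists r d, [/\ MT (cwunion pi rho) r, mle r q, Delta d & mle r d].
Proof.
move=> mpi mrho [ref seal] [[fq _] qsigma].
pose inpi a T := exists2 P, pi a = Some P & P T.
pose p : ptrees W := fun a =>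
  if q a is Some T then if `[< inpi a T >] then Some T else None else None.
pose u : ptrees W := fun a =>
  if q a is Some T then
    if `[< dom pi a /\ ~ inpi a T >] then Some T else None else None.
have pE a T : p a = Some T -> q a = Some T /\ inpi a T.
  by rewrite /p; case: (q a) => // S; case: asboolP => // aS [<-].
have uE a T : u a = Some T -> [/\ q a = Some T, dom pi a & ~ inpi a T].
  by rewrite /u; case: (q a) => // S; case: asboolP => // -[piS aS] [<-].
have domP (A : Type) (f : pfun W A) a : dom f a -> exists T, f a = Some T.
  by rewrite /dom /=; case: (f a) => // T _; exists T.
have MTp : MT pi p.
  apply: MTI => //; last by move=> a T /pE[].
  by apply: sub_finite_set fq => a /domP[T /pE[qT _]]; rewrite /dom /= qT.
have MTu : MT rho u.
  apply: MTI => //; last first.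
    move=> a T /uE[/qsigma[Q]]; rewrite /cwunion /inpi /dom /=.
    case: (pi a) => // P; case: (rho a) => [R|] [<-].
      by move=> [PT|RT] _ nPT; [case: nPT; exists P|exists R].
    by move=> PT _ []; exists P.
  by apply: sub_finite_set fq => a /domP[T /uE[qT _ _]]; rewrite /dom /= qT.
have [||q' [MTq' q'p q'u]] := seal p u MTp MTu.
- by move=> a /domP[T /uE[]].
- apply/seteqP; split=> // a [/domP[T /uE[qa _ naT]] /domP[S /pE[]]].
  by rewrite qa => -[<-].
move=> /(fin_covered_meet mrho ref MTu (_ : forall v, _ v -> _)).
case=> [v []//|v [w [[MTv _ Dv] domw MTw wu wv]]].
have q'w a T S : q' a = Some T -> w a = Some S -> False.
  move=> q'a wa; suff : (dom q' `&` dom u) a by rewrite q'u.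
  by rewrite -domw; split; rewrite /dom /= ?q'a ?wa.
have q'pi a T : q' a = Some T -> dom pi a.
  by move=> /(proj2 MTq')[P piP _]; rewrite /dom /= piP.
have wpi a T : w a = Some T -> dom pi a.
  move=> wa; have : dom w a by rewrite /dom /= wa.
  by rewrite domw => /domP[S /uE[]].
pose o : ptrees W := fun a => if pi a is Some _ then None else q a.
pose r := punion (punion q' w) o.
have rl a T : q' a = Some T -> r a = Some T by rewrite /r /punion => ->.
have rm a T : w a = Some T -> r a = Some T.
  move=> wa; rewrite /r /punion; case q'a: (q' a) => [S|]; last by rewrite wa.
  by have := q'w _ _ _ q'a wa.
have ro a T : ~ dom pi a -> q a = Some T -> r a = Some T.
  move=> pia qa; rewrite /r /punion.
  case q'a: (q' a) => [S|]; first by case: pia; exact: q'pi q'a.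
  case wa: (w a) => [S|]; first by case: pia; exact: wpi wa.
  by move: pia; rewrite /o /dom /=; case: (pi a) => // P [].
have rP a T : r a = Some T -> [\/ q' a = Some T, w a = Some T | q a = Some T].
  rewrite /r /punion /o; case: (q' a) => [S [<-]|]; first exact: Or31.
  case: (w a) => [S [<-]|]; first exact: Or32.
  by case: (pi a) => // qa; exact: Or33.
exists r, (punion v q'); split=> //.
- apply: MTI; first exact: cwunion_multiforcing.
    apply: (@sub_finite_set _ _ (dom q' `|` dom w `|` dom q)).
      move=> a /domP[T /rP[]] aT; [left; left|left; right|right];
        by rewrite /dom /= aT.
    by rewrite !finite_setU; split=> //; split; [case: MTq' => -[]|case: MTw => -[]].
  move=> a T /rP[/(proj2 MTq')[P]|/(proj2 MTw)[P]|/qsigma//].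
    exact: cwunionl.
  exact: cwunionr.
- move=> a T qa; case: (pselect (dom pi a)) => pia; last first.
    by exists T => //; exact: ro.
  case: (pselect (inpi a T)) => iaT.
    have /q'p[S q'a ST] : p a = Some T by rewrite /p qa; case: asboolP.
    by exists S => //; exact: rl.
  have /wu[S wa ST] : u a = Some T by rewrite /u qa; case: asboolP => // -[].
  by exists S => //; exact: rm.
- move=> a T; rewrite /punion; case va: (v a) => [S|].
    by move=> [<-]; have [V wa VS] := wv _ _ va; exists V => //; exact: rm.
  by move=> q'a; exists T => //; exact: rl.
Qed.

Lemma dforces_notin_mle (c : names W) p q Q :
  mle q p -> dforces_notin c p Q -> dforces_notin c q Q.
Proof.
move=> qp [s nQs cps]; exists s => // n /cps[k ck pk].
by exists k => //; exact: mle_trans pk.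
Qed.

End Multitrees.

Section ForcingTheory.
Variable P : forcing_notion.
Implicit Types (p q r : P) (s t x y : name P) (A : formula P).

Lemma dense_below_mono A p q : fle q p -> dense_below A p -> dense_below A q.
Proof. by move=> qp Ap r rq; apply: Ap; exact: fle_trans qp. Qed.

Lemma fimp_mono A B p q : fle q p -> fimp A B p -> fimp A B q.
Proof. by move=> qp Ap r rq; apply: Ap; exact: fle_trans qp. Qed.

Lemma feq_mono s t p q : fle q p -> feq s t p -> feq s t q.
Proof.
case: s t => [D x a] [E y b] qp [st ts]; split.
  by move=> i r rq; apply: st; exact: fle_trans qp.
by move=> j r rq; apply: ts; exact: fle_trans qp.
Qed.

Lemma fmem_mono s t p q : fle q p -> fmem s t p -> fmem s t q.
Proof. by case: t => E y b; exact: dense_below_mono. Qed.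

Lemma freal_mono x p q : fle q p -> freal x p -> freal x q.
Proof.
move=> qp [xpt [tot fn]]; split; [|split].
- by move=> z; apply: fimp_mono qp (xpt z).
- by move=> n; apply: dense_below_mono qp (tot n).
- by move=> n i j; apply: fimp_mono qp (fn n i j).
Qed.

Lemma dense_belowW A p : (forall q, fle q p -> A q) -> dense_below A p.
Proof. by move=> Ap q qp; exists q; [exact: fle_refl|exact: Ap]. Qed.

Lemma feq_refl s p : feq s s p.
Proof.
elim: s p => D x IH a p; split=> i q qp qa; apply: dense_belowW => r rq;
  by exists i; [exact: fle_trans qa|exact: IH].
Qed.

Lemma feq_sym s t p : feq s t p -> feq t s p.
Proof.
elim: s t p => D x IH a [E y b] p [st ts]; split=> [j|i] q qp qb r rq.
  have [r' r'r [i ri xy]] := ts j q qp qb r rq.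
  by exists r' => //; exists i => //; exact: IH.
have [r' r'r [j rj xy]] := st i q qp qb r rq.
by exists r' => //; exists j => //; exact: IH.
Qed.

Lemma fmem_name (I : Type) (e : I -> name P) (w : I -> P) i p :
  fle p (w i) -> fmem (e i) (Name e w) p.
Proof.
move=> pw; apply: dense_belowW => q qp; exists i; first exact: fle_trans pw.
exact: feq_refl.
Qed.

Lemma feq_fmem_name x (I : Type) (e : I -> name P) (w : I -> P) i p :
  feq x (Name e w) p -> fle p (w i) -> fmem (e i) x p.
Proof.
case: x => D x a [_ xe] pw q qp.
have [r rq [j ra xer]] := xe i p (fle_refl p) pw q qp.
by exists r => //; exists j => //; exact: feq_sym.
Qed.

Definition fcompatible p q := exists2 r, fle r p & fle r q.

Lemma fcompatible_sym p q : fcompatible p q -> fcompatible q p.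
Proof. by case=> r rp rq; exists r. Qed.

Lemma maximal_antichain (D : set P) : exists A : set P, [/\ A `<=` D,
  forall p q, A p -> A q -> p <> q -> ~ fcompatible p q &
  forall p, D p -> exists2 q, A q & fcompatible p q].
Proof.
pose anti (A : set P) := A `<=` D /\
  forall p q, A p -> A q -> p <> q -> ~ fcompatible p q.
have [F Fanti totF|A [[AD Aanti] Amax]] := @Zorn_bigcup P anti.
  split=> [p [X FX Xp]|p q [X FX Xp] [Y FY Yq]]; first exact: (proj1 (Fanti _ FX)).
  have [XY|YX] := totF _ _ FX FY.
    by apply: (proj2 (Fanti _ FY)) => //; exact: XY.
  by apply: (proj2 (Fanti _ FX)) => //; exact: YX.
exists A; split=> // p Dp; apply: contrapT => np.
have nAp q : A q -> ~ fcompatible p q by move=> Aq pq; apply: np; exists q.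
apply: (Amax (p |` A)).
  split; first by move=> q Aq; right.
  move=> /(_ p (or_introl erefl)) Ap; apply: (nAp p Ap).
  by exists p; exact: fle_refl.
split=> [q [->|/AD]//|q r [->|Aq] [->|Ar]].
- by move=> /(_ erefl).
- by move=> _; exact: nAp.
- by move=> _ /fcompatible_sym; exact: nAp.
- exact: Aanti.
Qed.

End ForcingTheory.


Section RealNames.
Variables (W : Type) (pi : mforcing W).
Hypothesis pi_multiforcing : multiforcing pi.
Let F := MT_forcing pi.
Implicit Types (c : names W) (e p q r : F) (x : name F).

Lemma fcompatibleP p q :
  compatible (MT pi) (sval p) (sval q) <-> fcompatible p q.
Proof.
split=> [[r [MTr rp rq]]|[r rp rq]]; first by exists (exist _ r MTr).
by exists (sval r); split=> //; exact: svalP.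
Qed.

Lemma ccc_antichain (A : set F) : ccc (MT pi) ->
  (forall p q, A p -> A q -> p <> q -> ~ fcompatible p q) ->
  countable [set sval p | p in A].
Proof.
move=> cccpi Aanti; apply: cccpi => [_ [p Ap <-]|]; first exact: svalP.
move=> _ _ [p Ap <-] [q Aq <-] npq /fcompatibleP; apply: Aanti => // pq.
by apply: npq; rewrite pq.
Qed.

Lemma fmem_cname c p q n i :
  c (sval q, (n, i)) -> fle p q -> fmem (npoint n i) (cname pi c) p.
Proof.
move=> cq pq.
exact: (@fmem_name F _ _ _ (exist (fun y => c (sval y.1, y.2)) (q, (n, i)) cq)).
Qed.

Lemma feq_cname_fmem c x p q n i : feq x (cname pi c) p ->
  c (sval q, (n, i)) -> fle p q -> fmem (npoint n i) x p.
Proof.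
move=> xc cq; have xcE := feq_fmem_name xc.
exact: (xcE (exist (fun y => c (sval y.1, y.2)) (q, (n, i)) cq)).
Qed.

Lemma freal_feq_cname c x p : freal x p ->
  (forall n q, fle q p -> exists r e i,
    [/\ fle r q, c (sval e, (n, i)) & fle r e]) ->
  (forall q e n i, fle q p -> c (sval e, (n, i)) -> fle q e ->
    fmem (npoint n i) x q) ->
  feq x (cname pi c) p.
Proof.
case: x => D y b realx cdense cx.
have [xpt [_ fn]] := realx.
split=> [k q qp qb|[[e [n i]] /= ce] q qp qe]; last first.
  move=> r rq; have [r' r'r [k rk yk]] := cx q e n i qp ce qe r rq.
  by exists r' => //; exists k => //; exact: feq_sym.
move=> r rq; have rp := fle_trans rq qp.
have [r1 r1r [n ny]] := xpt (y k) r rp (fmem_name y (fle_trans rq qb))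
  r (fle_refl r).
have [r2 r21 [i yni]] := ny r1 (fle_refl r1).
have r2p : fle r2 p by apply: fle_trans rp; exact: fle_trans r1r.
have [r3 [e [j [r32 ce r3e]]]] := cdense n r2 r2p.
have r3p := fle_trans r32 r2p.
have ij : i = j.
  apply: (fn n i j r3 r3p); split; last exact: cx ce r3e.
  apply: dense_belowW => r4 r43; have r42 := fle_trans r43 r32.
  exists k; last by apply: feq_sym; exact: feq_mono r42 yni.
  by apply: fle_trans qb; apply: fle_trans rq; apply: fle_trans r1r;
    exact: fle_trans r21.
exists r3; first by apply: fle_trans r32 _; exact: fle_trans r21 r1r.
rewrite -ij in ce; exists (exist (fun z => c (sval z.1, z.2)) (e, (n, i)) ce) => //.
exact: feq_mono r32 yni.
Qed.

Lemma dforces_init_finit c x p s : name_over (MT pi) c ->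
  (forall q r n i, fle q p -> c (sval r, (n, i)) -> fle q r ->
    fmem (npoint n i) x q) ->
  dforces_init c (sval p) s -> finit s x p.
Proof.
move=> cpi xc cps n q qp ns.
have [k ck pk] := cps n ns.
apply: (xc q (exist _ k (cpi _ _ _ ck))) => //.
exact: fle_trans (pk : fle p (exist _ k (cpi _ _ _ ck))).
Qed.

Lemma non_principal_not_generic c x a p : name_over (MT pi) c ->
  non_principal pi a c -> feq x (cname pi c) p ->
  ~ fgeneric_real a x p.
Proof.
move=> cpi [_ _ npc] xc genp.
have [e [MTe [T ea [s nTs ces]]] ep] := npc _ (svalP p).
pose e' : F := exist _ e MTe.
apply: nTs; apply: (genp e' T e' ep ea e' (fle_refl _)).
- by apply: dense_belowW => q.
- exact: fle_refl.
apply: (@dforces_init_finit c) => // q r n i qe cr qr.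
apply: feq_cname_fmem cr qr; apply: feq_mono xc.
exact: fle_trans (ep : fle e' p).
Qed.

Section NongenericReal.
Hypothesis pi_regular : regular pi.
Variables (x : name F) (q0 : F) (a : W).
Hypothesis ccc_pi : ccc (MT pi).
Hypothesis real_x : freal x q0.
Hypothesis nongeneric_x : fnot (fgeneric_real a x) q0.

(* Conditions deciding the n-th digit of the real that is x if q0 is in the
   generic filter and the ground model real 000... otherwise; the latter is
   never the generic real, since no branch of a perfect tree is isolated. *)
Let decides n i p : Prop :=
  (fle p q0 /\ fmem (npoint n i) x p) \/ (~ fcompatible p q0 /\ i = false).

Lemma decides_dense n p : exists2 q, fle q p & exists i, decides n i q.
Proof.
have [[r rp rq0]|npq] := pselect (fcompatible p q0); last first.
  by exists p; [exact: fle_refl|exists false; right].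
have [_ [tot _]] := real_x; have [q qr [i nix]] := tot n r rq0.
exists q; first exact: fle_trans rp.
by exists i; left; split=> //; exact: fle_trans rq0.
Qed.

Lemma decides_uniq n i j p q : decides n i p -> decides n j q ->
  fcompatible p q -> i = j.
Proof.
have far r r' : fle r r' -> ~ fcompatible r' q0 -> fle r q0 -> False.
  by move=> rr' nr' rq0; apply: nr'; exists r.
move=> [[pq0 pi_]|[np ->]] [[qq0 qj]|[nq ->]] [r rp rq] //.
- have [_ [_ fn]] := real_x.
  apply: (fn n i j r (fle_trans rp pq0)); split.
    exact: fmem_mono rp pi_.
  exact: fmem_mono rq qj.
- by case: (far _ _ rq nq (fle_trans rp pq0)).
- by case: (far _ _ rp np (fle_trans rq qq0)).
Qed.

Lemma small_name_of_nongeneric : exists c,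
  [/\ [/\ name_over (MT pi) c, real_name c, small c, complete pi c
        & non_principal pi a c]
    & feq x (cname pi c) q0].
Proof.
have /choice[A AP] n :=
  maximal_antichain [set p | exists i, decides n i p].
pose c : names W := [set z | exists e, [/\ A z.2.1 e, decides z.2.1 z.2.2 e
  & sval e = z.1]].
have cE e n i : A n e -> decides n i e -> c (sval e, (n, i)).
  by move=> Ae ei; exists e.
have meetA n p : exists q e i, [/\ fle q p, fle q e, A n e & decides n i e].
  have [r rp [i ri]] := decides_dense n p.
  have [_ _ /(_ r (ex_intro _ i ri))[e Ae [q qr qe]]] := AP n.
  have [/(_ _ Ae)[j ej] _ _] := AP n.
  by exists q, e, j; split=> //; exact: fle_trans rp.
have meetsA m p : exists2 q, fle q p &
    forall n, n < m -> exists e i, [/\ fle q e, A n e & decides n i e].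
  elim: m => [|m [q qp qA]]; first by exists p => //; exact: fle_refl.
  have [r [e [i [rq re Ae ei]]]] := meetA m q.
  exists r; first exact: fle_trans qp.
  move=> n; rewrite ltnS leq_eqVlt => /orP[/eqP->|nm]; first by exists e, i.
  have [e' [i' [qe' Ae' ei']]] := qA _ nm.
  by exists e', i'; split=> //; exact: fle_trans qe'.
have cpi : name_over (MT pi) c.
  by move=> p n i [e [_ _ /= <-]]; exact: svalP.
have npc : non_principal pi a c.
  split=> [p []//|p q [MTp [T pa pT]] MTq qp|p0 MTp0].
    have [S qa ST] := qp _ _ pa; split=> //; exists S => //.
    have [s nTs ps] := dforces_notin_mle qp pT.
    by exists s => // /ST.
  pose p : F := exist _ p0 MTp0.
  suff [q [s [T [qp qa nTs qs]]]] : exists q s T, [/\ fle q p, sval q a = Some T,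
      ~ T s & forall r n e i, n < size s -> fle r q -> fle r e ->
        decides n i e -> i = nth false s n].
    have [r rq rA] := meetsA (size s) q; have [S ra ST] := rq _ _ qa.
    exists (sval r) => //; last by exact: (fle_trans rq qp).
    split; first exact: svalP.
    exists S => //; exists s; first by move=> /ST.
    move=> n ns; have [e [i [re Ae ei]]] := rA n ns.
    by exists (sval e) => //; rewrite -(qs r n e i)//; exact: cE.
  have [[r rp rq0]|npq] := pselect (fcompatible p q0).
    apply: contrapT => nex; apply: (nongeneric_x rq0).
    move=> p1 T r1 r1r p1a r2 r21 genp1 s r3 r32 xs; apply: contrapT => nTs.
    have [r4 r43 r4p1] := genp1 _ r32; have [S r4a ST] := r4p1 _ _ p1a.
    apply: nex; exists r4, s, S.
    have r4r : fle r4 r.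
      by apply: fle_trans r43 _; apply: fle_trans r32 _; exact: fle_trans r21 _.
    split=> //; first exact: fle_trans rp; first by move=> /ST.
    move=> r5 n e i ns r54 r5e ei.
    apply: (decides_uniq (q := r5) ei); last by exists r5 => //; exact: fle_refl.
    left; split; last exact: xs (fle_trans r54 r43) ns.
    by apply: fle_trans rq0; exact: fle_trans r4r.
  have [r [T [rp ra]]] : exists r T, fle r p /\ sval r a = Some T.
    case pa: (p0 a) => [T|]; first by exists p, T; split=> //; exact: fle_refl.
    have [T [Q piQ QT]] : exists T, exists2 Q, pi a = Some Q & Q T.
      apply: contrapT => nex; apply: (nongeneric_x (fle_refl q0)).
      move=> p1 T r _ p1a; case: nex; exists T.
      exact: (proj2 (svalP p1)) p1a.
    have [|S|r [MTr rp ra]] := @MT_extend _ pi p0 a T pi_multiforcing MTp0.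
    - by exists Q.
    - by rewrite pa.
    by exists (exist _ r MTr), T.
  have [Q piQ QT] := proj2 (svalP r) _ _ ra.
  have [perQ resQ] := pi_multiforcing piQ.
  have [[t0 Tt0] _ /(_ _ Tt0)[t [_ _ _ Tt]]] := perQ _ QT.
  have [||q [MTq qr qa]] := @MT_extend _ pi (sval r) a
    (tree_restrict T (rcons t true)) pi_multiforcing (svalP r).
  - by exists Q => //; exact: resQ.
  - by move=> S; rewrite ra => -[<-] u [].
  pose q' : F := exist _ q MTq.
  have q'p : fle q' p by exact: (fle_trans (qr : fle q' r) rp).
  exists q', (nseq (size t).+1 false), (tree_restrict T (rcons t true)).
  split=> // [[_ tt]|q1 n e i _ q1q q1e [[eq0 _]|[_ ->]]].
  - have : nseq (size t).+1 false = rcons t true.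
      by case/orP: tt; rewrite prefixE take_oversize
        ?size_nseq ?size_rcons// => /eqP ->.
    move=> /(congr1 (last true)); rewrite last_rcons.
    by elim: (size t).
  - by case: npq; exists q1; [exact: fle_trans q'p|exact: fle_trans eq0].
  - by rewrite nth_nseq; case: ifP.
exists c; split; first split=> //.
- split=> [p n i [e [_ _ /= <-]]|n p q [e [Ae ef /= <-]] [e' [Ae' et /= <-]]].
    by case: (svalP e).
  apply: contrapT => /(regular_compatible pi_multiforcing pi_regular
    (svalP e) (svalP e'))/fcompatibleP /(decides_uniq ef et).
  by [].
- move=> n; have [_ Aanti _] := AP n.
  apply: sub_countable (ccc_antichain ccc_pi Aanti); apply: subset_card_le.
  by move=> p [] [e [Ae _ /= <-]]; exists e.
- move=> n p MTp; have [q [e [i [qp qe Ae ei]]]] := meetA n (exist _ p MTp).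
  exists (sval q); last first.
    by exists (sval q); split=> //; [exact: svalP|exact: mle_refl].
  split; first exact: svalP.
  by exists (sval e) => //; case: i ei => ei; [right|left]; exact: cE.
apply: freal_feq_cname => // [n q qq0|q e' n i qq0 [e [Ae ei /= ee']] qe'].
  have [r [e [i [rq re Ae ei]]]] := meetA n q.
  by exists r, e, i; split=> //; exact: cE.
have qe : fle q e by rewrite /fle /= ee'.
case: ei => [[_ nix]|[ne _]]; first exact: fmem_mono nix.
by case: ne; exists q.
Qed.

End NongenericReal.
End RealNames.

Theorem theorem12p2 (W : Type) (R : rel W) (W_omega1 : is_omega1 R)
  (pi : mforcing W) (pi_multiforcing : multiforcing pi) (pi_regular : regular pi)
  (xi : W) (xi_pi : dom pi xi) :
  (ccc (MT pi) ->
   forall x : name (MT_forcing pi),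
     holds (fimp (freal x)
       (fiff (fnot (fgeneric_real xi x))
             (fex (fun c : names W =>
                fand (fground [/\ name_over (MT pi) c, real_name c, small c,
                                    complete pi c & non_principal pi xi c])
                     (feq x (cname pi c)))))))
  /\
  (forall (c : names W) (rho : mforcing W),
     name_over (MT pi) c -> real_name c -> complete pi c ->
     multiforcing rho -> avoids rho c pi xi ->
     holds (fnot (fex (fun Q : tree =>
       fand (fground (exists2 S, rho xi = Some S & S Q))
            (fbranch Q (cname (cwunion pi rho) c)))))).
Proof.
split=> [cccpi x p0 p _ realx|c rho cpi _ _ mrho [_ avoid] p0 p _ exQ].
  split=> [q qp nongen|q qp exc r rq genr].
    apply: dense_belowW => r rq.
    have [c [cP xc]] := small_name_of_nongeneric pi_multiforcing pi_regular cccpi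
      (freal_mono qp realx) nongen.
    by exists c; split=> //; exact: feq_mono rq xc.
  have [e er [c [[cpi _ _ _ npc] xc]]] := exc r rq.
  apply: (non_principal_not_generic cpi npc xc (a := xi)).
  by move=> p1 T q1 q1e; apply: genr; exact: fle_trans er.
have [r rp [Q [[S rhoS SQ] brQ]]] := exQ p (fle_refl p).
have [e [d [MTe er [_ _ dQ] ed]]] :=
  sealed_predense pi_multiforcing mrho (avoid _ _ rhoS SQ) (svalP r).
have [s nQs es] := dforces_notin_mle ed dQ.
pose e' : MT_forcing (cwunion pi rho) := exist _ e MTe.
apply: nQs; apply: (brQ s e' (er : fle e' r)).
apply: (@dforces_init_finit _ (cwunion pi rho) c) => //.
  by move=> k n i /cpi; exact: MT_cwunionl.
by move=> q k n i _; exact: fmem_cname.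
Qed.
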